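(* Let $d=2$ or $d=3$ and let $\boldsymbol{S}=\{S_1,S_2\}\subset\mathbb{R}^{d\times d}$. Suppose $P\in\mathbb{R}^{d\times d}$ is a symmetric positive-definite matrix with $P-S_k^TPS_k\ge0$ for $k=1,2$, and that $$\mathbb{K}_{\|\cdot\|_P}(S_1)\cap\mathbb{K}_{\|\cdot\|_P}(S_2)=\{0\}.$$ If $\mathbb{P}$ is a non-atomic ergodic Borel probability measure of the one-sided shift $\theta:\varSigma_2^+\to\varSigma_2^+$, then $$\|S_{\sigma_n}\cdots S_{\sigma_1}\|_P\to0\quad\text{as }n\to+\infty$$ for $\mathbb{P}$-a.e. $\sigma\in\varSigma_2^+$.
   Context: For a symmetric matrix $A$, $A\ge0$ means $x^TAx\ge0$ for all $x$. $\|x\|_P=\sqrt{x^TPx}$, and $\|\cdot\|_P$ also denotes the induced operator norm on matrices. $\mathbb{K}_{\|\cdot\|_P}(S_k)=\{x\in\mathbb{R}^d:\|S_kx\|_P=\|x\|_P\}$. $\varSigma_2^+=\{1,2\}^{\mathbb{N}}$ is the set of all switching signals $\sigma=(\sigma_n)_{n\ge1}$, with the product topology and its Borel $\sigma$-field; $\theta$ is the shift $(\sigma_n)_{n\ge1}\mapsto(\sigma_{n+1})_{n\ge1}$. Ergodic means $\theta$-invariant and ergodic. A measure is non-atomic if every singleton $\{\sigma\}$ has measure $0$. *)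

(* Defs.v *)
From HB Require Import structures.
From mathcomp Require Import all_boot all_order all_algebra.
From mathcomp Require Import all_classical all_reals all_analysis.

Set Implicit Arguments.
Unset Strict Implicit.
Unset Printing Implicit Defensive.

Import Order.TTheory GRing.Theory Num.Theory.
Import numFieldNormedType.Exports.

Local Open Scope classical_set_scope.
Local Open Scope ring_scope.

Section quadratic_norm.
Context {R : realType} {d : nat}.
Implicit Types (A P : 'M[R]_d) (x : 'cV[R]_d).

Definition qform A x : R := (x^T *m A *m x) 0 0.

(* psdmx and posdefmx do not include the symmetry of A. *)
Definition psdmx A : Prop := forall x, 0 <= qform A x.

Definition posdefmx A : Prop := forall x, x != 0 -> 0 < qform A x.

Definition Pnorm P x : R := Num.sqrt (qform P x).

Definition Pnorm_mx P A : R :=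
  sup [set Pnorm P (A *m x) | x in [set x | Pnorm P x <= 1]].

Definition isometric_set P A : set 'cV[R]_d :=
  [set x | Pnorm P (A *m x) = Pnorm P x].

End quadratic_norm.

(* The letters 1, 2 are the elements 0, 1 of 'I_2, and a sequence indexed by
   n >= 1 is a function of n - 1 : nat. *)
Definition signal : Type := prod_topology (fun _ : nat => discrete_topology 'I_2).

HB.instance Definition _ := Topological.on signal.
HB.instance Definition _ := isPointed.Build signal (fun=> ord0).

Notation borel_signal := (g_sigma_algebraType (@open signal)).

Definition shift (s : signal) : signal := fun n => s n.+1.

Section shift_measures.
Context {R : realType}.
Implicit Type mu : probability borel_signal R.

Definition shift_invariant mu : Prop :=
  forall A : set borel_signal, measurable A -> mu (shift @^-1` A) = mu A.

Definition shift_ergodic mu : Prop := shift_invariant mu /\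
  forall A : set borel_signal, measurable A -> shift @^-1` A = A ->
    mu A = 0%E \/ mu A = 1%E.

Definition nonatomic mu : Prop := forall s : borel_signal, mu [set s] = 0%E.

End shift_measures.

Fixpoint switching_prod {R : realType} {d : nat} (S : 'I_2 -> 'M[R]_d)
    (s : signal) (n : nat) : 'M[R]_d :=
  if n is m.+1 then S (s m) *m switching_prod S s m else 1%:M.

(* Main.v *)
(** Let E_m be the set of signals whose first m matrices preserve the P-norm of
    some nonzero vector. There are finitely many words of length m, so each time
    the shifted signal lies outside E_m the norm of the product shrinks by a
    uniform factor below 1. Hence, if the product does not tend to 0, then for
    every m the orbit of the signal is eventually in E_m, and by shift
    invariance such signals form a set of measure at most mu(E_m).

    The measures mu(E_m) tend to 0, because the intersection of the E_m is
    countable. As d <= 3, the isometric subspace of one letter a is at most a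
    line. The current vector of an isometric orbit determines the next letter,
    since the two isometric subspaces meet trivially, and at an occurrence of a
    the vector lies on that line; so the first occurrence of a determines the
    whole signal. *)

Require Import Defs.
From mathcomp Require Import all_boot all_order all_algebra.
From mathcomp Require Import all_classical all_reals all_analysis.
From mathcomp Require Import zify ring lra.

Set Implicit Arguments.
Unset Strict Implicit.
Unset Printing Implicit Defensive.

Import Order.TTheory GRing.Theory Num.Theory.
Import numFieldNormedType.Exports.

Local Open Scope classical_set_scope.
Local Open Scope ring_scope.

(** * Cauchy-Schwarz and comparison of quadratic forms *)

Section quadratic_forms.
Context {R : realType} {d : nat}.
Implicit Types (A B P Q : 'M[R]_d) (x y : 'cV[R]_d).

Lemma qform_mulmx P A x : qform P (A *m x) = qform (A^T *m P *m A) x.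
Proof. by rewrite /qform trmx_mul !mulmxA. Qed.

Lemma qformB P Q x : qform (P - Q) x = qform P x - qform Q x.
Proof. by rewrite /qform mulmxBr mulmxBl !mxE. Qed.

Lemma qformZ P (a : R) x : qform P (a *: x) = a ^+ 2 * qform P x.
Proof.
have xZ : (a *: x)^T = a *: x^T by rewrite linearZ.
by rewrite /qform xZ -scalemxAr -!scalemxAl scalerA mxE -expr2.
Qed.

Lemma qform0 P : qform P 0 = 0.
Proof. by rewrite /qform mulmx0 mxE. Qed.

Lemma qform_line Q x y (t : R) : Q^T = Q ->
  qform Q (x + t *: y) =
  qform Q x + t * (y^T *m Q *m x) 0 0 *+ 2 + t ^+ 2 * qform Q y.
Proof.
move=> Qsym.
have xy : (x^T *m Q *m y) 0 0 = (y^T *m Q *m x) 0 0.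
  have -> : y^T *m Q *m x = (x^T *m Q *m y)^T.
    by rewrite !trmx_mul trmxK Qsym mulmxA.
  by rewrite [RHS]mxE.
have tD : (x + t *: y)^T = x^T + t *: y^T by rewrite linearD /= linearZ.
rewrite /qform tD !mulmxDl !mulmxDr.
have mxD (a b : 'M[R]_1) : (a + b) 0 0 = a 0 0 + b 0 0 by rewrite mxE.
have mxZ c (a : 'M[R]_1) : (c *: a) 0 0 = c * a 0 0 by rewrite mxE.
rewrite -!scalemxAl -!scalemxAr !(mxD, mxZ) xy.
ring.
Qed.

(** The polynomial [t |-> qform Q (x + t *: y)] is nonnegative, which bounds its discriminant. *)
Lemma psdmx_cauchy Q x y : Q^T = Q -> psdmx Q ->
  (y^T *m Q *m x) 0 0 ^+ 2 <= qform Q x * qform Q y.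
Proof.
move=> Qsym Qpsd; set b : R := (y^T *m Q *m x) 0 0.
have ax := Qpsd x; have ay := Qpsd y.
have line t : 0 <= qform Q x + t * b *+ 2 + t ^+ 2 * qform Q y.
  by rewrite -(qform_line x y t Qsym).
have [y0|y0] := eqVneq (qform Q y) 0; last first.
  have ygt : 0 < qform Q y by rewrite lt_neqAle eq_sym y0.
  (* The minimiser of the polynomial. *)
  have := mulr_ge0 ay (line (- b / qform Q y)).
  have -> : qform Q y * (qform Q x + - b / qform Q y * b *+ 2 +
      (- b / qform Q y) ^+ 2 * qform Q y) = qform Q x * qform Q y - b ^+ 2.
    by field.
  lra.
rewrite y0 mulr0; have [->|b0] := eqVneq b 0; first by rewrite expr0n.
(* The polynomial is now affine with slope [2 * b]; at this [t] it equals [- qform Q x - 2], which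
   is negative. *)
have := line (- (qform Q x + 1) / b).
rewrite y0 mulr0 addr0 divfK //; lra.
Qed.

(** Cauchy-Schwarz for [x] and [Q *m x] bounds the fourth power of the Euclidean norm of [Q *m x] by
    0. *)
Lemma psdmx_ker Q x : Q^T = Q -> psdmx Q -> qform Q x = 0 -> Q *m x = 0.
Proof.
move=> Qsym Qpsd q0; have := psdmx_cauchy x (Q *m x) Qsym Qpsd.
rewrite q0 mul0r => h.
have : ((Q *m x)^T *m Q *m x) 0 0 = 0.
  by apply/eqP; rewrite -sqrf_eq0; apply/eqP; nra.
rewrite -mulmxA mxE => /eqP; rewrite psumr_eq0 => [/allP s0|i _]; last first.
  by rewrite mxE -expr2 sqr_ge0.
apply/matrixP => i j; rewrite (ord1 j) [in RHS]mxE.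
have := s0 i (mem_index_enum _); rewrite /= mxE -expr2 sqrf_eq0.
by move/eqP.
Qed.

Lemma qform_le_sqnorm A : exists2 C : R, 0 <= C &
  forall x, qform A x <= C * qform 1%:M x.
Proof.
have n1 x : qform 1%:M x = \sum_i x i 0 ^+ 2.
  by rewrite /qform mulmx1 mxE; apply: eq_bigr => i _; rewrite mxE expr2.
exists (\sum_i \sum_j `|A j i|) => [|x].
  by apply: sumr_ge0 => i _; apply: sumr_ge0.
rewrite /qform mxE mulr_suml; apply: ler_sum => i _.
rewrite mxE !mulr_suml; apply: ler_sum => j _.
have sq k : x k 0 ^+ 2 <= qform 1%:M x.
  by rewrite n1 (bigD1 k) //= lerDl sumr_ge0 // => l _; rewrite sqr_ge0.
have h : `|x j 0 * x i 0| <= qform 1%:M x.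
  have := sq i; have := sq j; case: (ler0P (x j 0 * x i 0)) => _; nra.
rewrite mxE (le_trans (ler_norm _)) // mulrAC normrM mulrC ler_wpM2l //.
Qed.

Lemma posdefmx_unit Q : posdefmx Q -> Q \in unitmx.
Proof.
move=> Qpd; rewrite -row_free_unit -kermx_eq0; apply/eqP/row_matrixP => i.
rewrite row0; apply/eqP; apply: contraT => n0.
have /Qpd : (row i (kermx Q))^T != 0 by rewrite -trmx0 (inj_eq trmx_inj).
by rewrite /qform trmxK -row_mul mulmx_ker row0 mul0mx mxE ltxx.
Qed.

Lemma posdefmx_psdmx Q : posdefmx Q -> psdmx Q.
Proof.
by move=> Qpd x; have [->|/Qpd/ltW//] := eqVneq x 0; rewrite qform0.
Qed.

(* Cauchy-Schwarz for the form [Q] applied to [x] and [Q^-1 x] bounds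
   [(x^T x)^2] by [qform Q x * qform Q^-1 x]. *)
Lemma sqnorm_le_posdefmx Q : Q^T = Q -> posdefmx Q ->
  exists2 C : R, 0 <= C & forall x, qform 1%:M x <= C * qform Q x.
Proof.
move=> Qsym Qpd; have Qu := posdefmx_unit Qpd.
have [C C0 hC] := qform_le_sqnorm (invmx Q).
exists C => // x; have := psdmx_cauchy x (invmx Q *m x) Qsym (posdefmx_psdmx Qpd).
have -> : (invmx Q *m x)^T *m Q *m x = x^T *m 1%:M *m x.
  by rewrite trmx_mul trmx_inv Qsym -!mulmxA (mulmxA (invmx Q)) mulVmx.
rewrite qform_mulmx trmx_inv Qsym mulVmx // mul1mx -/(qform 1%:M x).
have := hC x; have := posdefmx_psdmx Qpd x.
have : 0 <= qform 1%:M x.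
  by rewrite /qform mulmx1 mxE sumr_ge0 // => i _; rewrite mxE -expr2 sqr_ge0.
set n := qform 1%:M x; set q := qform Q x; set r := qform _ x => n0 q0 rn nq.
have : n * (n - C * q) <= 0 by nra.
have [->|n0'] := eqVneq n 0; first by move=> _; rewrite mulr_ge0.
by rewrite pmulr_rle0 ?subr_le0 // lt_neqAle eq_sym n0'.
Qed.

Lemma qform_le_posdefmx A Q : Q^T = Q -> posdefmx Q ->
  exists2 C : R, 1 <= C & forall x, qform A x <= C * qform Q x.
Proof.
move=> Qsym Qpd; have [C C0 hC] := sqnorm_le_posdefmx Qsym Qpd.
have [D D0 hD] := qform_le_sqnorm A.
(* The summand 1 ensures [1 <= C], so that [1 - C^-1] can later serve as a rate in [[0, 1)]. *)
exists (D * C + 1) => [|x]; first by rewrite lerDr mulr_ge0.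
have := hD x; have := hC x; have := posdefmx_psdmx Qpd x; nra.
Qed.

End quadratic_forms.

(** * Contractions of a quadratic norm and their isometric vectors *)

Section contractions.
Context {R : realType} {d : nat}.
Implicit Types (A P : 'M[R]_d) (x y : 'cV[R]_d).

Lemma isometric_setE P A x : psdmx P ->
  isometric_set P A x <-> qform P (A *m x) = qform P x.
Proof.
move=> Ppsd; rewrite /isometric_set /Pnorm /=; split=> [/eqP|-> //].
by rewrite eqr_sqrt // => /eqP.
Qed.

Definition contractive P A : Prop := psdmx (P - A^T *m P *m A).

Lemma contractiveP P A :
  contractive P A <-> forall x, qform P (A *m x) <= qform P x.
Proof.
split=> h x; first by have := h x; rewrite qformB -qform_mulmx subr_ge0.
by rewrite qformB -qform_mulmx subr_ge0.
Qed.

Definition has_isometric P A : Prop :=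
  exists2 y, y != 0 & qform P (A *m y) = qform P y.

Lemma defect_sym P A : P^T = P ->
  (P - A^T *m P *m A)^T = P - A^T *m P *m A.
Proof. by move=> Psym; rewrite linearB /= !trmx_mul trmxK Psym mulmxA. Qed.

(** Isometric vectors are the zeros of a positive semidefinite form, so they form a linear subspace,
    the kernel of the defect matrix. *)
Lemma defect_ker P A x : P^T = P -> contractive P A ->
  qform P (A *m x) = qform P x -> (P - A^T *m P *m A) *m x = 0.
Proof.
move=> Psym Ac Ax; apply: psdmx_ker => //; first exact: defect_sym.
by rewrite qformB -qform_mulmx Ax subrr.
Qed.

(** Without isometric vectors the defect form is positive definite and some multiple [C] of it
    dominates [P]; rearranging gives the rate [1 - C^-1]. *)
Lemma contraction_rate P A : P^T = P -> contractive P A ->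
  ~ has_isometric P A ->
  exists2 r, 0 <= r < 1 & forall x, qform P (A *m x) <= r * qform P x.
Proof.
move=> Psym Ac Aiso; pose Q := P - A^T *m P *m A.
have Qpd : posdefmx Q.
  move=> y y0; rewrite lt_neqAle Ac andbT eq_sym; apply/eqP => q0.
  apply: Aiso; exists y => //; apply/esym/eqP.
  by rewrite -subr_eq0 qform_mulmx -qformB q0.
have [C C1 hC] := qform_le_posdefmx P (defect_sym A Psym) Qpd.
have C0 : 0 < C by apply: lt_le_trans C1.
exists (1 - C^-1) => [|x].
  by rewrite subr_ge0 invf_le1 // C1 ltrBlDr ltrDl invr_gt0.
have := hC x; rewrite qformB -qform_mulmx -ler_pdivrMl //; lra.
Qed.

Lemma contraction_rate_seq P (L : seq 'M[R]_d) : P^T = P -> psdmx P ->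
  (forall A, A \in L -> contractive P A) ->
  exists2 r, 0 <= r < 1 & forall A, A \in L -> ~ has_isometric P A ->
    forall x, qform P (A *m x) <= r * qform P x.
Proof.
move=> Psym Ppsd; elim: L => [|A L IH] Lc.
  by exists 0 => //; rewrite lexx ltr01.
have [|r /andP[r0 r1] hr] := IH.
  by move=> B BL; apply: Lc; rewrite inE BL orbT.
have [Aiso|Aiso] := pselect (has_isometric P A).
  exists r => [|B]; first by rewrite r0.
  by rewrite inE => /predU1P[-> //|]; exact: hr.
have [|t /andP[t0 t1] ht] := contraction_rate Psym _ Aiso.
  by apply: Lc; rewrite mem_head.
exists (Num.max r t) => [|B]; first by rewrite le_max r0 gt_max r1 t1.
rewrite inE => /predU1P[-> _ x|BL Biso x].
  by apply: (le_trans (ht x)); rewrite ler_wpM2r // le_max lexx orbT.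
by apply: (le_trans (hr B BL Biso x)); rewrite ler_wpM2r // le_max lexx.
Qed.

Lemma Pnorm_mx_bound P A (c : R) : 0 <= c ->
  (forall x, qform P (A *m x) <= c ^+ 2 * qform P x) ->
  0 <= Pnorm_mx P A <= c.
Proof.
move=> c0 hA.
have ubc : ubound [set Pnorm P (A *m x) | x in [set x | Pnorm P x <= 1]] c.
  move=> _ [x /= x1 <-]; apply: (@le_trans _ _ (c * Pnorm P x)); last first.
    by rewrite -[leRHS]mulr1 ler_wpM2l.
  have -> : c * Pnorm P x = Num.sqrt (c ^+ 2 * qform P x).
    by rewrite sqrtrM ?sqr_ge0 // sqrtr_sqr ger0_norm.
  by rewrite ler_wsqrtr.
(* The value at the zero vector makes the set nonempty and its supremum nonnegative. *)
have mem0 : [set Pnorm P (A *m x) | x in [set x | Pnorm P x <= 1]] 0.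
  by exists 0; rewrite /= ?mulmx0 /Pnorm qform0 sqrtr0.
apply/andP; split; last by apply: ge_sup => //; exists 0.
by apply: ub_le_sup => //; exists c.
Qed.

(* In dimension at most [3] two subspaces meeting trivially cannot both have
   dimension at least [2]. *)
Lemma isometric_line (S : 'I_2 -> 'M[R]_d) P : (d <= 3)%N ->
  P^T = P -> psdmx P -> (forall k, contractive P (S k)) ->
  isometric_set P (S 0) `&` isometric_set P (S 1) = [set 0] ->
  exists a, forall x y, y != 0 ->
    isometric_set P (S a) x -> isometric_set P (S a) y ->
    exists c, x = c *: y.
Proof.
move=> d3 Psym Ppsd Sc Siso.
(* [kermx] is a left kernel; the defect matrix being symmetric, its rows span the transposes of the
   isometric vectors. *)
pose K k := kermx (P - (S k)^T *m P *m S k).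
have inK k x : isometric_set P (S k) x -> (x^T <= K k)%MS.
  move=> /(isometric_setE _ _ Ppsd) /(defect_ker Psym (Sc k)) Qx.
  by apply/sub_kermxP; rewrite -(defect_sym (S k) Psym) -trmx_mul Qx trmx0.
have Kin k (u : 'rV_d) : (u <= K k)%MS -> isometric_set P (S k) u^T.
  move=> /sub_kermxP uQ; apply/isometric_setE => //; apply/esym/eqP.
  rewrite -subr_eq0 qform_mulmx -qformB /qform trmxK uQ mul0mx mxE //.
have cap0 : (K 0 :&: K 1)%MS = 0.
  apply/row_matrixP => i; rewrite row0; apply: trmx_inj; rewrite trmx0.
  have : (row i (K 0 :&: K 1) <= K 0 :&: K 1)%MS by exact: row_sub.
  rewrite sub_capmx => /andP[/Kin h0 /Kin h1].
  have : (isometric_set P (S 0) `&` isometric_set P (S 1))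
    (row i (K 0 :&: K 1)%MS)^T by [].
  by rewrite Siso.
have [a ra] : exists a, (\rank (K a) <= 1)%N.
  have := mxrank_sum_cap (K 0) (K 1); rewrite cap0 mxrank0 addn0.
  have := rank_leq_col (K 0 + K 1)%MS.
  case: (leqP (\rank (K 0)) 1) => [|r0 rs rE]; first by exists 0.
  by exists 1; lia.
exists a => x y y0 /inK xK /inK yK.
have yT0 : y^T != 0 by rewrite -trmx0 (inj_eq trmx_inj).
have Ky : (K a <= y^T)%MS.
  have := mxrank_leqif_sup yK => -[rle <-].
  by rewrite eqn_leq rle rank_rV yT0 ra.
have /sub_rVP[c xc] := submx_trans xK Ky.
by exists c; apply: trmx_inj; rewrite linearZ.
Qed.

End contractions.

(* [shift] alone would be the translation of a normed module. *)
Local Notation shift := Defs.shift.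

Lemma iter_shift (s : signal) n i : iter n shift s i = s (n + i)%N.
Proof. by elim: n i => // n IH i; rewrite /= /shift IH addnS. Qed.

(** * Decay and rigidity of switched products *)

Section switched_products.
Context {R : realType} {d : nat}.
Variables (S : 'I_2 -> 'M[R]_d) (P : 'M[R]_d).
Hypotheses (P_sym : P^T = P) (P_posdef : posdefmx P).
Hypothesis S_contr : forall k, contractive P (S k).
Implicit Type s : signal.

Lemma switching_prodD s m n :
  switching_prod S s (m + n) =
  switching_prod S (iter m shift s) n *m switching_prod S s m.
Proof.
elim: n => [|n IH]; first by rewrite addn0 mul1mx.
by rewrite addnS /= IH iter_shift mulmxA.
Qed.

Lemma switching_prod_contr s n : contractive P (switching_prod S s n).
Proof.
apply/contractiveP; elim: n => [|n IH] x; first by rewrite mul1mx.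
rewrite /= -mulmxA; apply: le_trans (IH x).
by have /contractiveP := S_contr (s n); exact.
Qed.

Lemma qform_switching_prod_le s m n x : (m <= n)%N ->
  qform P (switching_prod S s n *m x) <= qform P (switching_prod S s m *m x).
Proof.
move=> /subnKC <-; rewrite switching_prodD -mulmxA.
by have /contractiveP := switching_prod_contr (iter m shift s) (n - m); exact.
Qed.

Lemma isometric_switching_prod_le s m n x : (m <= n)%N ->
  qform P (switching_prod S s n *m x) = qform P x ->
  qform P (switching_prod S s m *m x) = qform P x.
Proof.
move=> mn nx; apply/eqP; rewrite eq_le -{2}nx qform_switching_prod_le // andbT.
by have /contractiveP := switching_prod_contr s m; exact.
Qed.

(** A finite list covering all signals at once is what makes a contraction rate uniform in the
    signal. *)
Lemma switching_prod_finite n :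
  exists L : seq 'M[R]_d, (forall s, switching_prod S s n \in L) /\
    (forall A, A \in L -> contractive P A).
Proof.
elim: n => [|n [L [SL Lc]]].
  exists [:: 1%:M]; split=> [s|A]; first by rewrite mem_head.
  rewrite inE => /eqP ->; exact: (switching_prod_contr (fun=> 0) 0).
exists [seq S k *m B | k <- enum 'I_2, B <- L]; split=> [s|A].
  by apply/allpairsP; exists (s n, switching_prod S s n); rewrite mem_enum SL.
case/allpairsP => -[k B] /= [_ BL ->]; apply/contractiveP => x.
rewrite -mulmxA; apply: le_trans (_ : _ <= qform P (B *m x)) _.
  by have /contractiveP := S_contr k; exact.
by have /contractiveP := Lc B BL; exact.
Qed.

(** Each window of length [m] without isometric vector contributes a factor [r < 1], and the form
    never grows in between. *)
Lemma switching_prod_cvg0 s m :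
  (forall N, exists2 n, (N <= n)%N &
     ~ has_isometric P (switching_prod S (iter n shift s) m)) ->
  (fun n => Pnorm_mx P (switching_prod S s n)) @ \oo --> (0 : R).
Proof.
move=> io; have [L [SL Lc]] := switching_prod_finite m.
have P_psd := posdefmx_psdmx P_posdef.
have [r /andP[r0 r1] hr] := contraction_rate_seq P_sym P_psd Lc.
have pow k : exists N, forall x,
    qform P (switching_prod S s N *m x) <= r ^+ k * qform P x.
  elim: k => [|k [N hN]]; first by exists 0%N => x; rewrite mul1mx mul1r.
  (* The new window starts after the end [N] of the previous ones, so the windows are disjoint and
     the factors multiply. *)
  have [n Nn niso] := io N; exists (n + m)%N => x.
  rewrite switching_prodD -mulmxA exprS -mulrA.
  apply: (le_trans (hr _ (SL _) niso _)).
  rewrite ler_wpM2l //; apply: le_trans (hN x).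
  exact: qform_switching_prod_le.
apply/cvgrPdist_le => e e0.
(* The rate [r] acts on squared norms, hence the square of [e]. *)
have [k hk] : exists k, r ^+ k <= e ^+ 2.
  have := cvg_expr (z := r); rewrite ger0_norm // => /(_ r1).
  move=> /cvgrPdist_le /(_ (e ^+ 2) (exprn_gt0 2 e0)) [k _ /(_ k (leqnn k))].
  by rewrite /= sub0r normrN ger0_norm ?exprn_ge0 // => ?; exists k.
have [N hN] := pow k; exists N => // n /= Nn.
have /andP[n0 ne] : 0 <= Pnorm_mx P (switching_prod S s n) <= e.
  apply: Pnorm_mx_bound; first exact: ltW.
  move=> x; apply: (le_trans (qform_switching_prod_le s x Nn)).
  by apply: (le_trans (hN x)); rewrite ler_wpM2r.
by rewrite sub0r normrN ger0_norm.
Qed.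

Hypothesis S_isom :
  isometric_set P (S 0) `&` isometric_set P (S 1) = [set 0].

Lemma isometric_letter j k x : x != 0 ->
  isometric_set P (S j) x -> isometric_set P (S k) x -> j = k.
Proof.
move=> x0 xj xk; apply/eqP/negPn/negP => jk.
have : (isometric_set P (S 0) `&` isometric_set P (S 1)) x.
  have I2 (i : 'I_2) : i = 0 \/ i = 1.
    by case: i => -[|[|//]] ?; [left|right]; apply: val_inj.
  by case: (I2 j) (I2 k) jk xj xk => -> [] -> //; split.
by rewrite S_isom => /eqP; apply/negP.
Qed.

Variable a : 'I_2.
Hypothesis a_line : forall x y, y != 0 ->
  isometric_set P (S a) x -> isometric_set P (S a) y -> exists c, x = c *: y.

(* At time [k] both isometric vectors lie on the line of the letter [a], so
   they stay proportional, and each later letter is the only one that is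
   isometric on the current vector. *)
Lemma isometric_signal_unique s t k :
  (forall m, has_isometric P (switching_prod S s m)) ->
  (forall m, has_isometric P (switching_prod S t m)) ->
  s k = a -> t k = a -> (forall i, (i < k)%N -> s i = t i) -> s = t.
Proof.
move=> sE tE sk tk st_lt; apply/funext => i.
have [ik|ki] := ltnP i k; first exact: st_lt.
have P_psd := posdefmx_psdmx P_posdef.
(* The isometric vectors may depend on the length, so [i] is fixed first; length [i.+1] includes the
   letter of index [i]. *)
have [x x0 xs] := sE i.+1; have [y y0 yt] := tE i.+1.
have orbit (u : signal) z j : z != 0 -> (j <= i)%N ->
    qform P (switching_prod S u i.+1 *m z) = qform P z ->
    switching_prod S u j *m z != 0 /\
    isometric_set P (S (u j)) (switching_prod S u j *m z).
  move=> z0 ji uz; have jz := isometric_switching_prod_le (leqW ji) uz.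
  split; last first.
    apply/isometric_setE => //; rewrite mulmxA jz.
    exact: (isometric_switching_prod_le (m := j.+1) _ uz).
  apply/eqP => u0; have := P_posdef z0; rewrite -jz u0 qform0.
  by rewrite ltxx.
have prop j : (k + j <= i)%N -> exists c,
    switching_prod S s (k + j) *m x = c *: (switching_prod S t (k + j) *m y).
  elim: j => [|j IH] ji.
    rewrite addn0 in ji *.
    have [_] := orbit s x k x0 ji xs; rewrite sk => xa.
    have [y'0] := orbit t y k y0 ji yt; rewrite tk => ya.
    exact: a_line.
  rewrite addnS in ji *; have [c hc] := IH (ltnW ji).
  have [x'0 xj] := orbit s x _ x0 (ltnW ji) xs.
  have [y'0 yj] := orbit t y _ y0 (ltnW ji) yt.
  exists c; rewrite /= -!mulmxA hc.
  (* The letter of [t] is isometric on the vector of [y], hence on its multiple, the vector of [x];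
     so both letters agree. *)
  rewrite -(_ : s (k + j)%N = t (k + j)%N) ?scalemxAr //.
  apply: (isometric_letter x'0 xj); apply/isometric_setE => //.
  by rewrite hc -scalemxAr !qformZ; congr (_ * _); apply/isometric_setE.
have [c] := prop (i - k)%N (eq_leq (subnKC ki)); rewrite subnKC // => hc.
have [x'0 xj] := orbit s x i x0 (leqnn i) xs.
have [y'0 yj] := orbit t y i y0 (leqnn i) yt.
apply: (isometric_letter x'0 xj); apply/isometric_setE => //.
by rewrite hc -scalemxAr !qformZ; congr (_ * _); apply/isometric_setE.
Qed.

End switched_products.

(** * Measurability and the almost sure limit *)

Section signal_measure.
Context {R : realType}.

Lemma measurable_letter i (k : 'I_2) :
  measurable [set s : borel_signal | s i = k].
Proof.
apply: sub_sigma_algebra.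
pose p := @proj _ (fun _ : nat => discrete_topology 'I_2) i.
suff : @open signal (p @^-1` [set k]) by [].
apply: (@open_comp signal _ p).
  by move=> s _; exact: proj_continuous.
exact: discrete_open.
Qed.

Lemma measurable_signal1 (s : borel_signal) : measurable [set s].
Proof.
have -> : [set s] = \bigcap_i [set t : borel_signal | t i = s i].
  apply/seteqP; split=> [t -> //|t ts].
  by apply/funext => i; exact: (ts i I).
by apply: bigcapT_measurable => i; exact: measurable_letter.
Qed.

(** The product depends on finitely many letters, so [Q] can be arbitrary. The induction splits on
    the last letter and absorbs its matrix into [Q]. *)
Lemma measurable_switching_prod {d} (S : 'I_2 -> 'M[R]_d)
    (Q : 'M[R]_d -> Prop) n m :
  measurable [set s : borel_signal | Q (switching_prod S (iter n shift s) m)].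
Proof.
elim: m Q => [|m IH] Q /=.
  have [q|q] := pselect (Q 1%:M).
    by rewrite (_ : [set _ | _] = setT) //; apply/seteqP; split.
  by rewrite (_ : [set _ | _] = set0) //; apply/seteqP; split.
rewrite (_ : [set _ | _] = \bigcup_(k in [set: 'I_2])
    ([set s : borel_signal | s (n + m)%N = k] `&`
     [set s | Q (S k *m switching_prod S (iter n shift s) m)])).
  apply: fin_bigcup_measurable => [|k _]; first exact: finite_finset.
  apply: measurableI; first exact: measurable_letter.
  exact: (IH (fun B => Q (S k *m B))).
apply/seteqP; split=> [s /= sQ|s [k _ [/= <-]]]; rewrite ?iter_shift //.
by exists (s (n + m)%N) => //; split => //=; rewrite -iter_shift.
Qed.

(** The inner intersections increase with [N], so continuity from below applies. *)
Lemma measure_liminf_le (disp : measure_display) (T : measurableType disp)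
    (nu : {measure set T -> \bar R}) (F : (set T)^nat) (c : \bar R) :
  (forall n, measurable (F n)) -> (forall n, nu (F n) <= c)%E ->
  (nu (\bigcup_N \bigcap_n F (N + n)%N) <= c)%E.
Proof.
move=> mF Fc.
have mG N : measurable (\bigcap_n F (N + n)%N) by exact: bigcapT_measurable.
have cv : (fun N => nu (\bigcap_n F (N + n)%N)) @ \oo -->
    nu (\bigcup_N \bigcap_n F (N + n)%N).
  apply: (nondecreasing_cvg_mu (F := fun N => \bigcap_n F (N + n)%N)) => //.
    exact: bigcupT_measurable.
  move=> m n mn; apply/subsetPset => s sm i _.
  by rewrite -(subnKC mn) -addnA; exact: sm.
rewrite -(cvg_lim _ cv) //; apply: lime_le; first exact: cvgP cv.
apply: nearW => N; apply: le_trans (Fc N).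
by apply: le_measure; rewrite ?inE // => s /(_ 0%N I); rewrite addn0.
Qed.

Variable mu : probability borel_signal R.
Hypotheses (mu_inv : shift_invariant mu) (mu_nonatomic : nonatomic mu).

Variable d : nat.
Variables (S : 'I_2 -> 'M[R]_d) (P : 'M[R]_d).
Hypotheses (P_sym : P^T = P) (P_posdef : posdefmx P).
Hypothesis S_contr : forall k, contractive P (S k).
Hypothesis S_isom :
  isometric_set P (S 0) `&` isometric_set P (S 1) = [set 0].
Hypothesis d_le3 : (d <= 3)%N.

(** [isoset 0 m] is the set E_m, and [isoset n m] its preimage under [n] shifts. *)
Let isoset n m : set borel_signal :=
  [set s | has_isometric P (switching_prod S (iter n shift s) m)].

Let measurable_isoset n m : measurable (isoset n m).
Proof. exact: measurable_switching_prod. Qed.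

Let measure_isoset n m : mu (isoset n m) = mu (isoset 0 m).
Proof.
elim: n => // n <-; rewrite -(mu_inv (measurable_isoset n m)); congr (mu _).
by apply/seteqP; split=> s; rewrite /isoset /preimage /mkset iterSr.
Qed.

Let isoset_capT : mu (\bigcap_m isoset 0 m) = 0%E.
Proof.
have P_psd := posdefmx_psdmx P_posdef.
have [a aline] := isometric_line d_le3 P_sym P_psd S_contr S_isom.
have I2 (i j : 'I_2) : i <> a -> j <> a -> i = j.
  move=> ia ja; apply: val_inj; move: ia ja.
  case: a i j {aline} => -[|[|//]] ? [[|[|//]] ?] [[|[|//]] ?] // ia ja;
    exfalso; by [apply: ia; apply: val_inj | apply: ja; apply: val_inj].
have neg1 (D : set borel_signal) : (forall s t, D s -> D t -> s = t) ->
    mu.-negligible D.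
  move=> D1; have [->|/set0P[s Ds]] := eqVneq D set0.
    exact: negligible_set0.
  apply: (negligibleS (A := [set s])); first by move=> t /D1; exact.
  by apply/negligibleP; [exact: measurable_signal1|exact: mu_nonatomic].
apply: measure_negligible; first exact: bigcapT_measurable.
(* Signals are sorted by the first occurrence [k] of [a]. Before it only the other letter appears,
   so members of [F k] agree below [k] and then everywhere; [G] holds at most the constant signal of
   the other letter. *)
pose F k := [set s : borel_signal | (\bigcap_m isoset 0 m) s /\
  (s k = a /\ forall i, (i < k)%N -> s i <> a)].
pose G := [set s : borel_signal | forall i, s i <> a].
apply: (negligibleS (A := (\bigcup_k F k) `|` G)).
  move=> s sE; have [sa|sa] := pselect (exists k, s k == a).
    left; exists (ex_minn sa) => //; case: ex_minnP => k /eqP ska kmin.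
    split=> //; split=> // i ik /eqP /kmin; rewrite leqNgt ik //.
  by right=> i sia; apply: sa; exists i; apply/eqP.
apply: negligibleU.
  apply: negligible_bigcup => k; apply: neg1 => s t [sE [sk slt]] [tE [tk tlt]].
  apply: (isometric_signal_unique P_posdef S_contr S_isom aline _ _ sk tk).
  - by move=> m; exact: (sE m I).
  - by move=> m; exact: (tE m I).
  - by move=> i ik; apply: I2; [exact: slt|exact: tlt].
by apply: neg1 => s t sG tG; apply/funext => i; apply: I2; [exact: sG|exact: tG].
Qed.

Lemma switching_prod_ae_cvg0 :
  {ae mu, forall s : borel_signal,
    (fun n : nat => Pnorm_mx P (switching_prod S s n)) @ \oo --> (0 : R)}.
Proof.
(* Signals whose orbit is eventually in E_m. *)
pose L m := \bigcup_N \bigcap_n isoset (N + n)%N m.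
have mL m : measurable (L m).
  by apply: bigcupT_measurable => N; exact: bigcapT_measurable.
have Lle m : (mu (L m) <= mu (isoset 0 m))%E.
  apply: (measure_liminf_le (F := fun n => isoset n m)) => // n.
  by rewrite -(measure_isoset n m); exact: lexx.
have L0 : mu (\bigcap_m L m) = 0%E.
  apply/eqP; rewrite eq_le measure_ge0 andbT -isoset_capT.
  (* E_m decreases in [m], since a vector isometric for a product is isometric for its shorter
     initial products. *)
  have cv : (mu \o isoset 0) @ \oo --> mu (\bigcap_m isoset 0 m).
    apply: nonincreasing_cvg_mu => //.
    - by apply: le_lt_trans (ltry 1); exact: probability_le1.
    - exact: bigcapT_measurable.
    - move=> m n mn; apply/subsetPset => s [y y0 sy]; exists y => //.
      exact: (isometric_switching_prod_le (s := s) S_contr mn sy).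
  rewrite -(cvg_lim _ cv) //; apply: lime_ge; first exact: cvgP cv.
  apply: nearW => m; apply: le_trans (Lle m).
  apply: le_measure; rewrite ?inE //; first exact: bigcapT_measurable.
  by move=> s; exact.
(* This null set contains every signal without convergence: outside some [L m], the orbit leaves E_m
   infinitely often and the product tends to 0. *)
exists (\bigcap_m L m); split=> //; first exact: bigcapT_measurable.
move=> s ncvg m _; apply: contrapT => nL; apply: ncvg.
apply: (switching_prod_cvg0 P_sym P_posdef S_contr (m := m)) => N.
apply: contrapT => nN; apply: nL; exists N => // n _; apply: contrapT => niso.
by apply: nN; exists (N + n)%N; first exact: leq_addr.
Qed.

End signal_measure.

Theorem theoremB (R : realType) (d : nat) (hd : d = 2%N \/ d = 3%N)
    (S : 'I_2 -> 'M[R]_d) (P : 'M[R]_d)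
    (P_sym : P^T = P) (P_posdef : posdefmx P)
    (S_contr : forall k : 'I_2, psdmx (P - (S k)^T *m P *m S k))
    (S_isom : isometric_set P (S 0) `&` isometric_set P (S 1) = [set 0])
    (mu : probability borel_signal R)
    (mu_ergodic : shift_ergodic mu) (mu_nonatomic : nonatomic mu) :
  {ae mu, forall s : borel_signal,
    (fun n : nat => Pnorm_mx P (switching_prod S s n)) @ \oo --> (0 : R)}.
Proof.
have d3 : (d <= 3)%N by case: hd => ->.
exact: (switching_prod_ae_cvg0 mu_ergodic.1 mu_nonatomic
  P_sym P_posdef S_contr S_isom d3).
Qed.
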